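(* Let $N\in\mathbb{N}$, $D\ge1$ (real), and $a_0,\dots,a_N\in\mathbb{R}$. There exists an RNN $\mathcal{R}$ (with input and output dimension $1$) such that, for all $x\in[-D,D]$ and all $t\in\mathbb{N}_0$ with $t\ge16\log(N)$, $$\left|(\mathcal{R}\mathcal{D}x)[t]-\sum_{i=0}^Na_ix^i\right|\le\|a\|_1\,C_1\,4^{-C_2t},$$ with $C_1=16ND^{2N}$, $C_2=\frac{1}{4\lceil\log(N)\rceil}$ and $\|a\|_1=\sum_{i=0}^N|a_i|$ (for $N=1$, where $\lceil\log N\rceil=0$, we read $C_2=+\infty$ and $4^{-C_2t}=0$ for all $t\in\mathbb{N}_0$). Furthermore, the hidden state size of $\mathcal{R}$ satisfies $\mathcal{M}_{\mathrm{hid}}(\mathcal{R})\le80N+11$.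
   Context: Notation: $\mathbb{N}=\{1,2,\dots\}$, $\mathbb{N}_0=\mathbb{N}\cup\{0\}$; $\log$ is the logarithm to base $2$; $(\mathbb{R}^d)^{\mathbb{N}_0}$ is the space of sequences in $\mathbb{R}^d$ indexed by $\mathbb{N}_0$; $\rho(x)=\max(0,x)$, applied componentwise to vectors. RNN: An RNN with input dimension $d\in\mathbb{N}$, output dimension $d'\in\mathbb{N}$ and hidden state size $m\in\mathbb{N}$ is given by weights $A_h\in\mathbb{R}^{m\times m}$, $A_x\in\mathbb{R}^{m\times d}$, $A_o\in\mathbb{R}^{d'\times m}$, $b_h\in\mathbb{R}^m$, $b_o\in\mathbb{R}^{d'}$. The hidden state operator $\mathcal{K}:(\mathbb{R}^d)^{\mathbb{N}_0}\to(\mathbb{R}^m)^{\mathbb{N}_0}$ maps an input sequence $(x[t])_{t\in\mathbb{N}_0}$ to $(\mathcal{K}x)[t]=h[t]$, where $h[-1]=0$ and $h[t]=\rho(A_hh[t-1]+A_xx[t]+b_h)$ for $t\in\mathbb{N}_0$. The output mapping is $\mathcal{Q}(h)=A_oh+b_o$. The associated RNN is the operator $\mathcal{R}=\mathcal{Q}\mathcal{K}$, $(\mathcal{R}x)[t]=\mathcal{Q}((\mathcal{K}x)[t])$. Write $\mathcal{M}_{\mathrm{hid}}(\mathcal{R})=m$. The operator $\mathcal{D}:\mathbb{R}^d\to(\mathbb{R}^d)^{\mathbb{N}_0}$ is defined by $(\mathcal{D}x)[0]=x$ and $(\mathcal{D}x)[t]=0$ for $t\ge1$. *)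

(* Defs.v *)
From mathcomp Require Import all_boot all_order all_algebra.
From mathcomp Require Import all_classical all_reals all_analysis.

Set Implicit Arguments.
Unset Strict Implicit.
Unset Printing Implicit Defensive.

Import Order.TTheory GRing.Theory Num.Theory.
Local Open Scope ring_scope.

(* Vectors are column vectors; a sequence in R^d indexed by {0, 1, 2, ...} is
   a function nat -> 'cV[R]_d. *)

Definition relu (R : realType) (m : nat) (v : 'cV[R]_m) : 'cV[R]_m :=
  map_mx (fun y : R => Num.max 0 y) v.

Record RNN (R : realType) (d d' : nat) := MkRNN {
  hidden_size : nat;
  hidden_size_gt0 : (0 < hidden_size)%N;
  A_h : 'M[R]_(hidden_size, hidden_size);
  A_x : 'M[R]_(hidden_size, d);
  A_o : 'M[R]_(d', hidden_size);
  b_h : 'cV[R]_hidden_size;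
  b_o : 'cV[R]_d' }.

Definition hidden_step (R : realType) (d d' : nat) (net : RNN R d d')
    (h : 'cV[R]_(hidden_size net)) (v : 'cV[R]_d) : 'cV[R]_(hidden_size net) :=
  relu (A_h net *m h + A_x net *m v + b_h net).

(* The value at t = 0 uses the convention h[-1] = 0. *)
Fixpoint hidden_state (R : realType) (d d' : nat) (net : RNN R d d')
    (x : nat -> 'cV[R]_d) (t : nat) : 'cV[R]_(hidden_size net) :=
  if t is t'.+1 then hidden_step (hidden_state net x t') (x t)
  else hidden_step 0 (x 0%N).

Definition output_map (R : realType) (d d' : nat) (net : RNN R d d')
    (h : 'cV[R]_(hidden_size net)) : 'cV[R]_d' :=
  A_o net *m h + b_o net.

Definition rnn_op (R : realType) (d d' : nat) (net : RNN R d d')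
    (x : nat -> 'cV[R]_d) : nat -> 'cV[R]_d' :=
  fun t => output_map (hidden_state net x t).

(* The operator called D in the theory: x at time 0, then zero input. *)
Definition impulse (R : realType) (d : nat) (x : 'cV[R]_d) : nat -> 'cV[R]_d :=
  fun t => if t is 0%N then x else 0.

Definition log2 (R : realType) (y : R) : R := ln y / ln 2.

Definition C1 (R : realType) (N : nat) (D : R) : R :=
  16 * N%:R * D ^+ (2 * N).

(* Meaningful only for N >= 2: for N = 1 the ceiling is 0 and the constant is
   to be read as +oo, which [decay] takes into account. *)
Definition C2 (R : realType) (N : nat) : R :=
  (4 * (Num.ceil (log2 (N%:R : R)))%:~R)^-1.

(* 4 ^ (- C2 t), with the convention 4 ^ (- oo t) = 0, at t = 0 as well. *)
Definition decay (R : realType) (N t : nat) : R :=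
  if N == 1%N then 0 else 4 `^ (- (C2 R N * t%:R)).

(* Main.v *)
Require Import Defs.
From HB Require Import structures.
From mathcomp Require Import all_boot all_order all_algebra.
From mathcomp Require Import all_classical all_reals all_analysis.
From mathcomp Require Import zify ring lra.

Set Implicit Arguments.
Unset Strict Implicit.
Unset Printing Implicit Defensive.

Import Order.TTheory GRing.Theory Num.Theory.
Local Open Scope ring_scope.

(** After rescaling [x] to [z = x / D] in [[-1, 1]], the powers of [z] are arranged in a
    binary tree, [z^i = z^(i/2) * z^(i - i/2)], and each product is the difference of the
    squares of [(u + v) / 2] and [(u - v) / 2].

    A squaring unit keeps [A], [P] and [W = 4^-s] with [A + P^2 / W = p^2] and
    [0 <= P <= W]; the update
      [A' = A + 2 relu (P - W/2)], [P' = P/2 - relu (P - W/2)], [W' = W/4]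
    preserves this, so [A + P] approximates [p^2] within [W/4].  It is Yarotsky's
    sawtooth construction, written homogeneously so that one ReLU layer performs it.

    A clock restarts all units simultaneously; at a restart every unit latches its
    current product, and the latched values become the new inputs.  Values of depth [m]
    in the tree are thus correct up to the accuracy of the last [m] runs.  Runs number
    [q L, ..., q L + L - 1], where [L] is the ceiling of [log2 N], all have length [2^q],
    so at time [t] the last [L] complete runs have length at least [t / (4 L)].

    The clock uses two counters that exchange their roles: while one counts down to the
    end of the current run, the other counts up to the length of the next one, by [1] per
    step, or by [2] during the last run before the length doubles.  This avoids
    the multiplication of an unbounded quantity by a bit. *)

(** * Networks described by linear forms over a finite type of neurons *)

Inductive linform (R I : Type) : Type :=
| Lvar of I
| Lscale of R & linform R I
| Ladd of linform R I & linform R I.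

Arguments Lvar {R I}.

Declare Scope linform_scope.
Delimit Scope linform_scope with lin.
Bind Scope linform_scope with linform.
Notation "f + g" := (Ladd f g) : linform_scope.
Notation "a *: f" := (Lscale a f) : linform_scope.
Notation "f - g" := (Ladd f (Lscale (-1) g)) : linform_scope.

Fixpoint lin_eval (R : nzRingType) (I : Type) (f : linform R I) (h : I -> R) : R :=
  match f with
  | Lvar i => h i
  | Lscale c f => c * lin_eval f h
  | Ladd f g => lin_eval f h + lin_eval g h
  end.

Fixpoint lin_coef (R : nzRingType) (I : eqType) (f : linform R I) (j : I) : R :=
  match f with
  | Lvar i => (j == i)%:R
  | Lscale c f => c * lin_coef f j
  | Ladd f g => lin_coef f j + lin_coef g j
  end.

Lemma lin_evalE (R : nzRingType) (I : finType) (f : linform R I) (h : I -> R) :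
  lin_eval f h = \sum_j lin_coef f j * h j.
Proof.
elim: f => [i|c f IHf|f IHf g IHg] /=.
- rewrite (bigD1 i) //= eqxx mul1r big1 ?addr0 // => j /negPf ->.
  by rewrite mul0r.
- by rewrite IHf mulr_sumr; apply: eq_bigr => j _; rewrite mulrA.
- by rewrite IHf IHg -big_split; apply: eq_bigr => j _; rewrite mulrDl.
Qed.

Section LinearFormNetwork.
Variables (R : realType) (I : finType) (i0 : I).
Variables (form : I -> linform R I) (bias inw : I -> R) (out : linform R I).

(** The impulse is seen only at time 0, where the previous hidden state is 0. Hence [inw] occurs
    only in the base case and [form] only in the step. *)
Fixpoint traj (x : R) (t : nat) : I -> R :=
  match t with
  | 0 => fun i => Num.max 0 (inw i * x + bias i)
  | t'.+1 => fun i => Num.max 0 (lin_eval (form i) (traj x t') + bias i)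
  end.

Lemma card_neurons_gt0 : (0 < #|I|)%N.
Proof. by apply/card_gt0P; exists i0. Qed.

Definition linform_net : RNN R 1 1 :=
  MkRNN card_neurons_gt0
    (\matrix_(i, j) lin_coef (form (enum_val i)) (enum_val j))
    (\matrix_(i, _) inw (enum_val i))
    (\matrix_(_, j) lin_coef out (enum_val j))
    (\col_i bias (enum_val i)) 0.

Lemma linform_net_hidden (x : R) t i :
  hidden_state linform_net (impulse (const_mx x)) t i ord0
  = traj x t (enum_val i).
Proof.
elim: t i => [|t IHt] i; rewrite /= /hidden_step /relu !mxE; congr Num.max.
- rewrite big1 ?add0r => [|j _]; last by rewrite !mxE mulr0.
  by rewrite big_ord1 !mxE.
- congr (_ + _); rewrite big_ord1 !mxE mulr0 addr0 lin_evalE.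
  rewrite [RHS](reindex_onto enum_val enum_rank); last by move=> j _; rewrite enum_rankK.
  apply: eq_big => [j|j _]; first by rewrite enum_valK eqxx.
  by rewrite !mxE IHt.
Qed.

Lemma linform_netE (x : R) t :
  rnn_op linform_net (impulse (const_mx x)) t ord0 ord0
  = lin_eval out (traj x t).
Proof.
rewrite /rnn_op /output_map !mxE addr0 lin_evalE.
rewrite [RHS](reindex_onto enum_val enum_rank); last by move=> j _; rewrite enum_rankK.
apply: eq_big => [j|j _]; first by rewrite enum_valK eqxx.
by rewrite mxE linform_net_hidden.
Qed.

End LinearFormNetwork.

(** * The neurons *)

(** In [Fire], [Count], [Rate] and [Carry] the bit selects one of the two counters. [Rate] supplies
    the second unit when counting by 2, and [Carry] sends the phase back to 0. For [Input] the bit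
    is a sign: neurons are nonnegative, so $x/D$ is split into its positive and negative parts. *)
Inductive clock_neuron :=
| One | Mode | Phase | Weight | Restart
| Fire of bool | Count of bool | Rate of bool | Carry of bool | Input of bool.

Inductive square_neuron := Halved | Kink | Acc | Fresh of bool.

Definition clock_code (c : clock_neuron) : 'I_10 * bool :=
  match c with
  | One => (inord 0, false) | Mode => (inord 1, false)
  | Phase => (inord 2, false) | Weight => (inord 3, false)
  | Restart => (inord 4, false)
  | Fire b => (inord 5, b) | Count b => (inord 6, b) | Rate b => (inord 7, b)
  | Carry b => (inord 8, b) | Input b => (inord 9, b)
  end.

Definition clock_decode (p : 'I_10 * bool) : clock_neuron :=
  match val p.1 with
  | 0 => One | 1 => Mode | 2 => Phase | 3 => Weight | 4 => Restart
  | 5 => Fire p.2 | 6 => Count p.2 | 7 => Rate p.2 | 8 => Carry p.2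
  | _ => Input p.2
  end.

Lemma clock_codeK : cancel clock_code clock_decode.
Proof. by case=> [|||||b|b|b|b|b]; rewrite /clock_decode /= inordK. Qed.

HB.instance Definition _ := Finite.copy clock_neuron (can_type clock_codeK).

Definition square_code (c : square_neuron) : 'I_4 * bool :=
  match c with
  | Halved => (inord 0, false) | Kink => (inord 1, false)
  | Acc => (inord 2, false) | Fresh b => (inord 3, b)
  end.

Definition square_decode (p : 'I_4 * bool) : square_neuron :=
  match val p.1 with
  | 0 => Halved | 1 => Kink | 2 => Acc | _ => Fresh p.2
  end.

Lemma square_codeK : cancel square_code square_decode.
Proof. by case=> [|||b]; rewrite /square_decode /= inordK. Qed.

HB.instance Definition _ := Finite.copy square_neuron (can_type square_codeK).

Definition neuron (N : nat) : Type :=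
  (clock_neuron + 'I_N.+1 * bool * square_neuron + 'I_N.+1 * bool)%type.

HB.instance Definition _ N := Finite.on (neuron N).

(** The codes allow at most 20 clock neurons and 8 neurons per squaring unit. With two units and two
    latch neurons per power this gives $20 + (N+1)(2 \cdot 8 + 2)$. *)
Lemma card_neuron N : (#|{: neuron N}| <= 18 * N + 38)%N.
Proof.
have := leq_card _ (can_inj clock_codeK).
have := leq_card _ (can_inj square_codeK).
rewrite !card_sum !card_prod !card_ord !card_bool.
set c := #|{: clock_neuron}|; set s := #|{: square_neuron}|; nia.
Qed.

(** * The clock *)

Lemma max0_eq (R : realDomainType) (v y : R) :
  (v <= 0 -> y = 0) -> (0 <= v -> y = v) -> Num.max 0 v = y.
Proof. by move=> h0 hv; case: (lerP 0 v) => [/hv|/ltW/h0] ->. Qed.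

Definition gap (L n : nat) : nat := (2 ^ (n %/ L))%N.

Definition last_gap (L n : nat) : bool := (n %% L).+1 == L.

(* [clock L t = (n, r)]: at time [t] exactly [n] gaps are over and [r] steps of
   the current one have been made. *)
Fixpoint clock (L t : nat) : nat * nat :=
  if t is t'.+1 then
    let: (n, r) := clock L t' in
    if r.+1 == gap L n then (n.+1, 0%N) else (n, r.+1)
  else (0, 0)%N.

Lemma clockS L t : clock L t.+1 =
  let: (n, r) := clock L t in
  if r.+1 == gap L n then (n.+1, 0%N) else (n, r.+1).
Proof. by []. Qed.

Lemma gap_gt0 L n : (0 < gap L n)%N.
Proof. by rewrite expn_gt0. Qed.

Lemma modnS_last L n : (0 < L)%N ->
  (n.+1 %% L)%N = (if last_gap L n then 0 else (n %% L).+1)%N.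
Proof.
move=> L0; have := ltn_pmod n L0.
rewrite /last_gap -(addn1 n) -modnDml addn1.
by case: eqP => [-> _|h1 h2]; [rewrite modnn|rewrite modn_small //; lia].
Qed.

Lemma gapS L n : (0 < L)%N ->
  gap L n.+1 = (if last_gap L n then 2 * gap L n else gap L n)%N.
Proof.
move=> L0; rewrite /gap.
have := modnS_last n L0; have := divn_eq n.+1 L; have := divn_eq n L.
rewrite /last_gap; case: eqP => [h1|h1] e1 e2 e3; last by congr (2 ^ _)%N; nia.
by rewrite -expnS; congr (2 ^ _)%N; nia.
Qed.

Lemma clock_lt L t : ((clock L t).2 < gap L (clock L t).1)%N.
Proof.
elim: t => [|t]; first exact: gap_gt0.
rewrite /=; case: (clock L t) => n r /=; case: eqP => /= h1 h2; first exact: gap_gt0.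
by rewrite ltn_neqAle h2 andbT; apply/eqP.
Qed.

(** With $q = \lfloor n/L \rfloor$, the finished blocks of $L$ gaps take $L(1 + 2 + \dots + 2^{q-1})
    = L 2^q - L$ steps, and the current block has taken $(n \bmod L) 2^q + r$. *)
Lemma clock_time L t : (0 < L)%N ->
  (t + L = (L + (clock L t).1 %% L) * gap L (clock L t).1 + (clock L t).2)%N.
Proof.
move=> L0; elim: t => [|t]; first by rewrite /= /gap mod0n div0n; lia.
rewrite addSn => ->; rewrite /=; case: (clock L t) => n r /=; case: eqP => h /=; last by lia.
have := gapS n L0; have := modnS_last n L0; rewrite /last_gap; case: eqP => h1 -> -> ; nia.
Qed.

(** * The weights of the network as linear forms *)

Section PolynomialNetwork.
Variables (R : realType) (N L : nat).

Local Notation form := (linform R (neuron N)).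

Definition ck (c : clock_neuron) : form := Lvar (inl (inl c)).
Definition sq (i : 'I_N.+1) (b : bool) (c : square_neuron) : form :=
  Lvar (inl (inr (i, b, c))).
Definition latch (i : 'I_N.+1) (b : bool) : form := Lvar (inr (i, b)).

Definition sgn (b : bool) : R := (-1) ^+ b.

Definition tick : form := (ck (Fire false) + ck (Fire true))%lin.
Definition mode : form := (ck Mode + ck (Fire false) - ck (Fire true))%lin.
Definition in_mode (b : bool) : form := (if b then mode else ck One - mode)%lin.
Definition counter (b : bool) : form :=
  (ck (Count b) + ck (Rate b) - ck (Fire (~~ b)))%lin.
Definition phase : form :=
  (ck Phase + tick - L%:R *: (ck (Carry false) + ck (Carry true)))%lin.
(* [0] in the last gap before the length doubles, negative in the other ones *)
Definition last_phase : form := (phase - (L%:R - 1)%R *: ck One)%lin.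
Definition width : form := (4^-1 *: ck Weight + ck Restart)%lin.

(** This is $P$, and [partial_sum] is $A$. The [Fresh] neurons are the positive and negative parts
    of a new input, so their sum is its absolute value; the sign is irrelevant for squaring. *)
Definition remainder (i : 'I_N.+1) (b : bool) : form :=
  (2^-1 *: sq i b Halved - sq i b Kink
   + (sq i b (Fresh false) + sq i b (Fresh true)))%lin.
Definition partial_sum (i : 'I_N.+1) (b : bool) : form :=
  (sq i b Acc + 2 *: sq i b Kink)%lin.

Definition input : form := (ck (Input false) - ck (Input true))%lin.

(* The powers 0 and 1 are exact: the squaring units with these indices are never read. *)
Definition running (i : 'I_N.+1) : form :=
  match val i with
  | 0 => ck One
  | 1 => input
  | _ => (partial_sum i false + remainder i false
          - (partial_sum i true + remainder i true))%lin
  end.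

(** A latched value in $[-1, 1]$ is stored with 1 added, to survive the ReLU. After time 0 it sits
    in the [false] neuron if it was kept and in the [true] neuron if it was just loaded; the other
    one is 0. *)
Definition latched (i : 'I_N.+1) : form :=
  match val i with
  | 0 => ck One
  | 1 => input
  | _ => (latch i false + latch i true - ck One)%lin
  end.

Definition lo (i : 'I_N.+1) : 'I_N.+1 := inord i./2.
Definition hi (i : 'I_N.+1) : 'I_N.+1 := inord (uphalf i).

Definition mean (g : 'I_N.+1 -> form) (i : 'I_N.+1) (b : bool) : form :=
  (2^-1 *: (g (lo i) + sgn b *: g (hi i)))%lin.

(* With no bias outside [One], all neurons but [One] and [Input] are [0] at time 0,
   which is also the initial configuration of the clock.  A bit [b] multiplies
   a quantity [v] in [[0, M]] as [relu (v - M (1 - b))]. *)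
Definition preact (c : neuron N) : form :=
  match c with
  | inl (inl One) => 0 *: ck One
  | inl (inl Mode) => mode
  | inl (inl Phase) => phase
  | inl (inl Weight) => width - tick
  | inl (inl Restart) => tick
  | inl (inl (Fire b)) => in_mode b - counter b
  | inl (inl (Count b)) => counter b + ck One - 2 *: in_mode b
  | inl (inl (Rate b)) => in_mode (~~ b) + last_phase
  | inl (inl (Carry b)) => in_mode b - counter b + last_phase
  | inl (inl (Input b)) => ck (Input b)
  | inl (inr (i, b, Halved)) => remainder i b - tick
  | inl (inr (i, b, Kink)) => remainder i b - 2^-1 *: width - tick
  | inl (inr (i, b, Acc)) => partial_sum i b - tick
  | inl (inr (i, b, Fresh s)) => sgn s *: mean running i b - ck One + tick
  | inr (i, false) => latched i + ck One - 2 *: tick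
  | inr (i, true) => running i - ck One + 2 *: tick
  end%lin.

Definition bias (c : neuron N) : R :=
  if c is inl (inl One) then 1 else 0.

Definition input_weight (D : R) (c : neuron N) : R :=
  if c is inl (inl (Input b)) then sgn b / D else 0.

Variables (D x : R).

Definition state (t : nat) : neuron N -> R :=
  traj preact bias (input_weight D) x t.

Definition value (f : form) (t : nat) : R := lin_eval f (state t).

Lemma state0 c : state 0 c = Num.max 0 (input_weight D c * x + bias c).
Proof. by []. Qed.

Lemma stateS t c : state t.+1 c = Num.max 0 (value (preact c) t + bias c).
Proof. by []. Qed.

Lemma value_One t : value (ck One) t = 1.
Proof. by case: t => [|t]; rewrite /value /state /= mul0r add0r max_r. Qed.

Lemma value_input t : value input t = x / D.
Proof.
have i0 b : value (ck (Input b)) t = Num.max 0 (sgn b * (x / D)).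
  elim: t => [|t IHt]; first by rewrite /value /state /= addr0; congr Num.max; ring.
  rewrite /value /= stateS addr0 [value _ _]IHt; apply: max_r.
  by rewrite le_max lexx.
have -> : value input t
    = value (ck (Input false)) t + (-1) * value (ck (Input true)) t by [].
rewrite !i0 /sgn expr0 expr1.
by case: (lerP 0 (x / D)) => h; [rewrite max_r ?max_l|rewrite max_l ?max_r]; lra.
Qed.

(** * The clock neurons simulate [clock] *)

Local Notation sck c t := (state t (inl (inl c))).
Local Notation ssq i b c t := (state t (inl (inr (i, b, c)))).
Local Notation slatch i b t := (state t (inr (i, b))).

Lemma value_tickE t : value tick t = sck (Fire false) t + sck (Fire true) t.
Proof. by []. Qed.

Lemma value_mode t :
  value mode t = sck Mode t + sck (Fire false) t - sck (Fire true) t.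
Proof. by rewrite /value /=; ring. Qed.

Lemma value_in_mode b t :
  value (in_mode b) t = if b then value mode t else 1 - value mode t.
Proof. by case: b; rewrite // -(value_One t) /value /=; ring. Qed.

Lemma value_counter b t : value (counter b) t
  = sck (Count b) t + sck (Rate b) t - sck (Fire (~~ b)) t.
Proof. by rewrite /value /=; ring. Qed.

Lemma value_phase t : value phase t
  = sck Phase t + value tick t - L%:R * (sck (Carry false) t + sck (Carry true) t).
Proof. by rewrite /value /=; ring. Qed.

Lemma value_last_phase t : value last_phase t = value phase t - (L%:R - 1).
Proof. by rewrite /value /= [sck One t]value_One; ring. Qed.

Lemma state_Mode t : sck Mode t.+1 = Num.max 0 (value mode t).
Proof. by rewrite stateS addr0. Qed.

Lemma state_Phase t : sck Phase t.+1 = Num.max 0 (value phase t).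
Proof. by rewrite stateS addr0. Qed.

Lemma state_Fire b t :
  sck (Fire b) t.+1 = Num.max 0 (value (in_mode b) t - value (counter b) t).
Proof. by rewrite stateS addr0 /value /=; congr Num.max; ring. Qed.

Lemma state_Count b t : sck (Count b) t.+1
  = Num.max 0 (value (counter b) t + 1 - 2 * value (in_mode b) t).
Proof.
by rewrite stateS addr0 /value /= [sck One t]value_One; congr Num.max; ring.
Qed.

Lemma state_Rate b t : sck (Rate b) t.+1
  = Num.max 0 (value (in_mode (~~ b)) t + value last_phase t).
Proof.
by rewrite stateS addr0 /value /= [sck One t]value_One; congr Num.max; ring.
Qed.

Lemma state_Carry b t : sck (Carry b) t.+1
  = Num.max 0 (value (in_mode b) t - value (counter b) t + value last_phase t).
Proof.
by rewrite stateS addr0 /value /= [sck One t]value_One; congr Num.max; ring.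
Qed.

(** The counter indexed by the parity of $n$ runs down to 0 at the last step of the gap. The other
    one is then one step short of [gap L n.+1]; at the exchange [Fire] takes 1 off it, so that it
    starts its descent from [gap L n.+1] minus 1. *)
Definition clock_invariant (t : nat) : Prop :=
  let: (n, r) := clock L t in
  [/\ value mode t = (odd n)%:R,
      value phase t = (n %% L)%:R &
      forall b, value (counter b) t =
        if odd n == b then (gap L n)%:R - 1 - r%:R
        else (1 + (last_gap L n)%:R) * r%:R].

Lemma tick_clock (L0 : (0 < L)%N) t : clock_invariant t ->
  clock_invariant t.+1 /\ value tick t.+1 = ((clock L t.+1).2 == 0)%:R.
Proof.
rewrite /clock_invariant /=; case E: (clock L t) => [n r] [hm hp hc].
have := clock_lt L t; rewrite E /= => rlt.
have gE : (gap L n.+1)%:R = (1 + (last_gap L n)%:R) * (gap L n)%:R :> R.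
  by rewrite gapS //; case: (last_gap L n) => /=; rewrite ?natrM; ring.
have ltL := ltn_pmod n L0.
(* Integrality makes the ReLU conjunctions exact: outside the last phase [last_phase] is at most
   $-1$, and before the end of a gap the descending counter is at least 1 ([fireE]). *)
have lastE : if last_gap L n then (n %% L)%:R = L%:R - 1 :> R
             else (n %% L)%:R <= L%:R - 2 :> R.
  rewrite /last_gap; case: eqP => h.
    by rewrite -{2}h -natr1 addrK.
  have : ((n %% L).+2 <= L)%N by lia.
  by rewrite -(ler_nat R) -addn2 natrD; lra.
have pE : (n.+1 %% L)%:R
    = (if last_gap L n then 0 else (n %% L)%:R + 1) :> R.
  by rewrite modnS_last //; case: (last_gap L n); rewrite // -natr1.
have fireE : if r.+1 == gap L n then (gap L n)%:R = r%:R + 1 :> R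
             else r%:R + 2 <= (gap L n)%:R :> R.
  case: eqP => h; first by rewrite -h -natr1.
  have : (r.+2 <= gap L n)%N by lia.
  by rewrite -(ler_nat R) -addn2 natrD; lra.
have r0 : 0 <= r%:R :> R by [].
have in_modeE b : value (in_mode b) t = (odd n == b)%:R.
  by rewrite value_in_mode hm; case: b; case: odd; rewrite /=; lra.
have last_phaseE : value last_phase t = (n %% L)%:R - (L%:R - 1).
  by rewrite value_last_phase hp.
have fire b : state t.+1 (inl (inl (Fire b)))
    = ((r.+1 == gap L n) && (odd n == b))%:R.
  rewrite state_Fire in_modeE hc.
  move: fireE; case: eqP => _ /= hf; case: (odd n == b) => /=;
    case: (last_gap L n) => /=; apply: max0_eq => ?; lra.
have carry b : state t.+1 (inl (inl (Carry b)))
    = [&& r.+1 == gap L n, last_gap L n & odd n == b]%:R.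
  rewrite state_Carry in_modeE hc last_phaseE.
  move: fireE lastE; case: eqP => _ /= hf; case: (odd n == b) => /=;
    case: (last_gap L n) => /= hl; apply: max0_eq => ?; lra.
have rate b : state t.+1 (inl (inl (Rate b)))
    = (last_gap L n && (odd n != b))%:R.
  rewrite state_Rate in_modeE last_phaseE.
  move: lastE; case: (odd n) b => [] [] /=;
    case: (last_gap L n) => /= hl; apply: max0_eq => ?; lra.
have count b : state t.+1 (inl (inl (Count b)))
    = if odd n == b then (gap L n)%:R - 1 - r%:R - (r.+1 != gap L n)%:R
      else (1 + (last_gap L n)%:R) * r%:R + 1.
  rewrite state_Count in_modeE hc.
  move: fireE; case: eqP => _ /= hf; case: (odd n == b) => /=;
    case: (last_gap L n) => /=; apply: max0_eq => ?; lra.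
have md : state t.+1 (inl (inl Mode)) = (odd n)%:R.
  by rewrite state_Mode hm max_r.
have ph : state t.+1 (inl (inl Phase)) = (n %% L)%:R.
  by rewrite state_Phase hp max_r.
have tickE : value tick t.+1 = (r.+1 == gap L n)%:R.
  rewrite value_tickE !fire.
  by case: (_ == gap _ _); case: odd; rewrite /= ?addr0 ?add0r.
split; last by rewrite tickE; case: (_ == gap _ _).
have -> : (if r.+1 == gap L n then (n.+1, 0%N) else (n, r.+1))
  = (if r.+1 == gap L n then n.+1 else n, if r.+1 == gap L n then 0%N else r.+1).
  by case: ifP.
split.
- rewrite value_mode md !fire.
  by case: (_ == gap _ _); rewrite /=; case: odd; rewrite /=; lra.
- rewrite value_phase tickE ph !carry.
  move: pE lastE; case: (_ == gap _ _); rewrite /= ?addr0 ?mulr0 ?oppr0 ?addr0 //.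
    by move=> ->; case: (last_gap L n); case: odd => /= hl; lra.
- move=> b; rewrite value_counter count rate fire.
  move: fireE; case: eqP => _ /= hf; rewrite ?gE ?hf -?(natr1 _ r);
  case: (odd n) b => [] [] /=; case: (last_gap L n) => /=; lra.
Qed.

Lemma clockP (L0 : (0 < L)%N) t : clock_invariant t.
Proof.
elim: t => [|t IHt]; last exact: (tick_clock L0 IHt).1.
have s0 c : (forall b, c <> Input b) -> c <> One -> sck c 0 = 0.
  by case: c => [|||||b|b|b|b|b] h h1 //; rewrite state0 /= ?mul0r ?add0r ?maxxx //; case: (h b).
split.
- by rewrite value_mode !s0 //=; lra.
- by rewrite value_phase value_tickE !s0 // mod0n; lra.
- move=> b; rewrite value_counter !s0 //= /gap div0n expn0 mulr0.
  by case: b => /=; lra.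
Qed.

Lemma value_tick (L0 : (0 < L)%N) t :
  value tick t.+1 = ((clock L t.+1).2 == 0)%:R.
Proof. exact: (tick_clock L0 (clockP L0 t)).2. Qed.

Lemma value_tick0 : value tick 0 = 0.
Proof. by rewrite value_tickE !state0 /= mul0r add0r maxxx addr0. Qed.

(** * The squaring units *)

Lemma value_width t : value width t = 4^-1 * sck Weight t + sck Restart t.
Proof. by []. Qed.

Lemma value_remainder i b t : value (remainder i b) t
  = 2^-1 * ssq i b Halved t - ssq i b Kink t
    + (ssq i b (Fresh false) t + ssq i b (Fresh true) t).
Proof. by rewrite /value /=; ring. Qed.

Lemma value_partial_sum i b t :
  value (partial_sum i b) t = ssq i b Acc t + 2 * ssq i b Kink t.
Proof. by []. Qed.

Lemma value_low (i : 'I_N.+1) t : (i <= 1)%N ->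
  value (running i) t = (x / D) ^+ i /\ value (latched i) t = (x / D) ^+ i.
Proof.
by rewrite /running /latched; case: i => [[|[|]] //= _] _;
   rewrite ?expr0 ?expr1 ?value_One ?value_input.
Qed.

Lemma value_running (i : 'I_N.+1) t : (1 < i)%N -> value (running i) t
  = value (partial_sum i false) t + value (remainder i false) t
    - (value (partial_sum i true) t + value (remainder i true) t).
Proof. by case: i => [[|[|k]] hk] //= _; rewrite /value /=; ring. Qed.

Lemma value_latched (i : 'I_N.+1) t : (1 < i)%N ->
  value (latched i) t = slatch i false t + slatch i true t - 1.
Proof.
case: i => [[|[|k]] hk] //= _.
by rewrite /value /= [sck One t]value_One; ring.
Qed.

Lemma value_mean g i b t : value (mean g i b) t
  = 2^-1 * (value (g (lo i)) t + sgn b * value (g (hi i)) t).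
Proof. by []. Qed.

Lemma state_Weight t :
  sck Weight t.+1 = Num.max 0 (value width t - value tick t).
Proof. by rewrite stateS addr0 /value /=; congr Num.max; ring. Qed.

Lemma state_Restart t : sck Restart t.+1 = Num.max 0 (value tick t).
Proof. by rewrite stateS addr0. Qed.

Lemma state_Halved i b t : ssq i b Halved t.+1
  = Num.max 0 (value (remainder i b) t - value tick t).
Proof. by rewrite stateS addr0 /value /=; congr Num.max; ring. Qed.

Lemma state_Kink i b t : ssq i b Kink t.+1
  = Num.max 0 (value (remainder i b) t - 2^-1 * value width t - value tick t).
Proof. by rewrite stateS addr0 /value /=; congr Num.max; ring. Qed.

Lemma state_Acc i b t : ssq i b Acc t.+1
  = Num.max 0 (value (partial_sum i b) t - value tick t).
Proof. by rewrite stateS addr0 /value /=; congr Num.max; ring. Qed.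

Lemma state_Fresh i b s t : ssq i b (Fresh s) t.+1
  = Num.max 0 (sgn s * value (mean running i b) t - 1 + value tick t).
Proof.
by rewrite stateS addr0 /value /= [sck One t]value_One; congr Num.max; ring.
Qed.

Lemma state_keep i t : slatch i false t.+1
  = Num.max 0 (value (latched i) t + 1 - 2 * value tick t).
Proof.
by rewrite stateS addr0 /value /= [sck One t]value_One; congr Num.max; ring.
Qed.

Lemma state_load i t : slatch i true t.+1
  = Num.max 0 (value (running i) t - 1 + 2 * value tick t).
Proof.
by rewrite stateS addr0 /value /= [sck One t]value_One; congr Num.max; ring.
Qed.

(** * Boundedness and the effect of one step on the squaring units *)

Hypothesis L_gt0 : (0 < L)%N.
Hypothesis x_bound : `|x / D| <= 1.

(** These bounds hold whether or not the values are accurate, and they make every gate exact: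
    subtracting [tick] erases a quantity in $[0, 1]$. Bounding $A + P$ keeps the difference of two
    units in $[-1, 1]$. *)
Definition bounded (t : nat) : Prop :=
  [/\ 0 <= value width t <= 1,
      forall i b, 0 <= value (remainder i b) t <= value width t,
      forall i b, 0 <= value (partial_sum i b) t /\
        value (partial_sum i b) t + value (remainder i b) t <= 1 &
      forall i, `|value (latched i) t| <= 1].

Lemma low_bound i : `|(x / D) ^+ i| <= 1.
Proof. by rewrite normrX exprn_ile1. Qed.

Lemma running_bound t i : bounded t -> `|value (running i) t| <= 1.
Proof.
case=> _ hP hA _; have [i1|i1] := leqP i 1; first by rewrite (value_low _ i1).1 low_bound.
rewrite value_running // ler_norml.
have /andP[? ?] := hP i false; have /andP[? ?] := hP i true.
have [? ?] := hA i false; have [? ?] := hA i true; lra.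
Qed.

Lemma mean_bound g i b t : (forall i, `|value (g i) t| <= 1) ->
  `|value (mean g i b) t| <= 1.
Proof.
move=> h; rewrite value_mean; have := h (lo i); have := h (hi i).
by rewrite !ler_norml /sgn; case: b; rewrite ?expr0 ?expr1 => /andP[? ?] /andP[? ?]; lra.
Qed.

Lemma step_restart t : bounded t -> value tick t = 1 ->
  [/\ value width t.+1 = 1,
      forall i b, value (remainder i b) t.+1 = `|value (mean running i b) t|,
      forall i b, value (partial_sum i b) t.+1 = 0 &
      forall i, value (latched i) t.+1 = value (running i) t].
Proof.
move=> hb htick; have [/andP[w0 w1] hP hA hv] := hb.
have kink i b : ssq i b Kink t.+1 = 0.
  by rewrite state_Kink htick; have ? := hP i b; apply: max0_eq => ?; lra.
split.
- rewrite value_width state_Weight state_Restart htick (@max_r _ _ 0 1) //.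
  by rewrite max_l; lra.
- move=> i b; rewrite value_remainder state_Halved kink !state_Fresh htick.
  rewrite max_l; last by have := hP i b; lra.
  rewrite /sgn expr0 expr1; case: (ger0P (value (mean running i b) t)) => h.
    by rewrite max_r ?max_l; lra.
  by rewrite max_l ?max_r; lra.
- move=> i b; rewrite value_partial_sum kink state_Acc htick max_l; first by lra.
  by have [] := hA i b; have := hP i b; lra.
- move=> i; have [i1|i1] := leqP i 1.
    by rewrite (value_low _ i1).1 (value_low _ i1).2.
  rewrite value_latched // state_keep state_load htick.
  have := running_bound i hb; have := hv i; rewrite !ler_norml => ? ?.
  by rewrite max_l ?max_r; lra.
Qed.

Lemma step_refine t : bounded t -> value tick t = 0 ->
  let kink i b :=
    Num.max 0 (value (remainder i b) t - 2^-1 * value width t) in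
  [/\ value width t.+1 = 4^-1 * value width t,
      forall i b, value (remainder i b) t.+1
        = 2^-1 * value (remainder i b) t - kink i b,
      forall i b, value (partial_sum i b) t.+1
        = value (partial_sum i b) t + 2 * kink i b &
      forall i, value (latched i) t.+1 = value (latched i) t].
Proof.
move=> hb htick kink; have [/andP[w0 w1] hP hA hv] := hb.
have fresh i b s : ssq i b (Fresh s) t.+1 = 0.
  rewrite state_Fresh htick.
  have := @mean_bound running i b t (fun j => running_bound j hb); rewrite ler_norml /sgn => ?.
  by case: s; rewrite ?expr0 ?expr1; apply: max0_eq => // ?; lra.
split.
- by rewrite value_width state_Weight state_Restart htick subr0 maxxx addr0 max_r.
- move=> i b; rewrite value_remainder state_Halved state_Kink !fresh htick !subr0.
  by rewrite max_r; [rewrite /kink; lra | have := hP i b; lra].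
- move=> i b; rewrite value_partial_sum state_Kink state_Acc htick !subr0.
  by rewrite max_r //; have [] := hA i b.
- move=> i; have [i1|i1] := leqP i 1; first by rewrite !(value_low _ i1).2.
  rewrite value_latched // state_keep state_load htick.
  have := running_bound i hb; have := hv i; rewrite !ler_norml => ? ?.
  by rewrite max_r ?max_l; lra.
Qed.

Lemma tick01 t : value tick t = 0 \/ value tick t = 1.
Proof.
case: t => [|t]; first by left; exact: value_tick0.
by rewrite value_tick //; case: eqP; [right|left].
Qed.

Lemma boundedP t : bounded t.
Proof.
elim: t => [|t IHt].
  have sq0 i b c : ssq i b c 0 = 0 by rewrite state0 /= mul0r add0r maxxx.
  have ck0 : sck Weight 0 = 0 /\ sck Restart 0 = 0.
    by rewrite !state0 /= mul0r add0r maxxx.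
  split.
  - by rewrite value_width ck0.1 ck0.2; lra.
  - by move=> i b; rewrite value_remainder value_width ck0.1 ck0.2 !sq0; lra.
  - by move=> i b; rewrite value_partial_sum value_remainder !sq0; lra.
  - move=> i; have [i1|i1] := leqP i 1; first by rewrite (value_low _ i1).2 low_bound.
    (* Both latch neurons are 0 at time 0, so the latched value is $-1$, still within the bound. *)
    rewrite value_latched // !state0 /= mul0r add0r maxxx addr0 add0r.
    by rewrite normrN normr1.
have [h|h] := tick01 t.
  have [eW eP eA ev] := step_refine IHt h.
  case: IHt => /andP[w0 w1] hP hA hv; split.
  - by rewrite eW; lra.
  - move=> i b; rewrite eP eW; have /andP[? ?] := hP i b.
    by case: (lerP 0 (value (remainder i b) t - _)) => ?; lra.
  (* $A + P$ changes by $\max(-P/2, (P - W)/2)$, which is at most 0 because $0 \le P \le W$. *)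
  - move=> i b; rewrite eP eA; have /andP[? ?] := hP i b; have [? ?] := hA i b.
    by case: (lerP 0 (value (remainder i b) t - _)) => ?; lra.
  - by move=> i; rewrite ev.
have [eW eP eA ev] := step_restart IHt h.
have hm i b := @mean_bound running i b t (fun j => running_bound j IHt).
split.
- by rewrite eW; lra.
- by move=> i b; rewrite eP eW normr_ge0 hm.
- by move=> i b; rewrite eP eA add0r; split=> //; exact: hm.
- by move=> i; rewrite ev running_bound.
Qed.

(* The bound is stated for all [k] and [m] at once because a restart consumes
   one level [m] of the tree, at fixed run length [2^k]. *)
Definition accurate (n t : nat) : Prop :=
  forall k m (i : 'I_N.+1), (0 < k)%N -> (k * L + m <= n)%N -> (i <= 2 ^ m)%N ->
  `|value (latched i) t - (x / D) ^+ i| <= i.-1%:R * 4^-1 ^+ (2 ^ k).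

Definition squaring_invariant (r t : nat) : Prop :=
  value width t = 4^-1 ^+ r /\
  forall i b, value (partial_sum i b) t + value (remainder i b) t ^+ 2 * 4 ^+ r
    = value (mean latched i b) t ^+ 2.

(** A restart feeds the units with [mean running] in the same step in which [latched] takes over
    [running]; so each unit squares the mean of the values latched during its run. *)
Lemma restart_squaring t : value tick t = 1 -> squaring_invariant 0 t.+1.
Proof.
move=> h; have [eW eP eA ev] := step_restart (boundedP t) h.
split=> [|i b]; first by rewrite eW.
rewrite eA eP add0r expr0 mulr1 real_normK ?num_real //.
by rewrite !value_mean !ev.
Qed.

(** Below the kink, $P$ is halved while $1/W$ is multiplied by 4. Above it, $P' = (W - P)/2$, so $4
    P'^2/W = W - 2P + P^2/W$, and $A$ grows by $2P - W$. *)
Lemma refine_squaring r t : value tick t = 0 ->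
  squaring_invariant r t -> squaring_invariant r.+1 t.+1.
Proof.
move=> h [hW hI]; have [eW eP eA ev] := step_refine (boundedP t) h.
split=> [|i b]; first by rewrite eW hW exprS.
have -> : value (mean latched i b) t.+1 = value (mean latched i b) t.
  by rewrite !value_mean !ev.
rewrite -hI eA eP hW [4 ^+ r.+1]exprS.
have W4 : 4^-1 ^+ r * 4 ^+ r = 1 :> R by rewrite -exprMn mulVf ?expr1n.
set P := value (remainder i b) t; set A := value _ t.
move: W4; set W := 4^-1 ^+ r; set q := 4 ^+ r => W4.
case: (lerP 0 (P - _)) => _; last by field.
have -> : (2^-1 * P - (P - 2^-1 * W)) ^+ 2 * (4 * q)
  = P ^+ 2 * q - 2 * P * (W * q) + W * (W * q) by field.
by rewrite W4; field.
Qed.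

(** Each unit exceeds its square by $P - P^2/W = P(W - P)/W$, which lies in $[0, W/4]$. The two
    excesses have the same sign, so their difference is also within $W/4$. *)
Lemma running_error r t (i : 'I_N.+1) : squaring_invariant r t -> (1 < i)%N ->
  `|value (running i) t - value (latched (lo i)) t * value (latched (hi i)) t|
  <= 4^-1 ^+ r.+1.
Proof.
move=> [hW hI] i1; have [_ hP _ _] := boundedP t.
have W4 : 4^-1 ^+ r * 4 ^+ r = 1 :> R by rewrite -exprMn mulVf ?expr1n.
have err b : 0 <= value (remainder i b) t - value (remainder i b) t ^+ 2 * 4 ^+ r
               <= 4^-1 ^+ r.+1.
  have := hP i b; rewrite hW [4^-1 ^+ r.+1]exprS; set P := value _ t.
  move: W4; set W := 4^-1 ^+ r; set q := 4 ^+ r => W4 /andP[P0 PW].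
  have q0 : 0 < q by rewrite exprn_gt0.
  have e1 : P - P ^+ 2 * q = P * (W - P) * q.
    have -> : P * (W - P) * q = P * (W * q) - P ^+ 2 * q by ring.
    by rewrite W4 mulr1.
  have e2 : 4^-1 * W - (P - P ^+ 2 * q) = (P - 2^-1 * W) ^+ 2 * q.
    have -> : (P - 2^-1 * W) ^+ 2 * q
      = P ^+ 2 * q - P * (W * q) + 4^-1 * W * (W * q) by field.
    by rewrite W4; ring.
  rewrite -(subr_ge0 _ (4^-1 * W)) e2 e1; apply/andP.
  by split; apply: mulr_ge0 (ltW q0); rewrite ?sqr_ge0 ?mulr_ge0 ?subr_ge0.
rewrite value_running //.
have -> : value (latched (lo i)) t * value (latched (hi i)) t
    = value (mean latched i false) t ^+ 2 - value (mean latched i true) t ^+ 2.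
  by rewrite !value_mean /sgn expr0 expr1; field.
rewrite -!hI ler_norml; have /andP[? ?] := err false; have /andP[? ?] := err true.
by apply/andP; split; lra.
Qed.

(** All factors are at most 1 in absolute value, so the errors of both factors and of the new
    product simply add up; $i - 1$ counts the products in the tree of $z^i$. The run just ended has
    index $n \ge kL$, hence length at least $2^k$. *)
Lemma accurate_restart n r t : value tick t = 1 -> r.+1 = gap L n ->
  squaring_invariant r t -> accurate n t -> accurate n.+1 t.+1.
Proof.
move=> htick hr hS hn k m i k0 km im.
have [_ _ _ ->] := step_restart (boundedP t) htick.
have [i1|i1] := leqP i 1.
  by rewrite (value_low t i1).1 subrr normr0 mulr_ge0 // exprn_ge0 // invr_ge0.
case: m km im => [|m] km im; first by move: im i1; rewrite expn0; lia.
have loE : lo i = i./2 :> nat by rewrite /lo inordK //; have := ltn_ord i; lia.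
have hiE : hi i = uphalf i :> nat by rewrite /hi inordK //; have := ltn_ord i; lia.
have mm : (k * L + m <= n)%N by lia.
move: im; rewrite expnS => im.
have elo : `|_ - _| <= _ := hn k m (lo i) k0 mm ltac:(rewrite loE; lia).
have ehi : `|_ - _| <= _ := hn k m (hi i) k0 mm ltac:(rewrite hiE; lia).
have erun := running_error hS i1.
have egap : 4^-1 ^+ r.+1 <= 4^-1 ^+ (2 ^ k) :> R.
  rewrite hr /gap ler_wiXn2l ?invr_ge0 //; first by rewrite invf_le1 ?ler1n.
  by rewrite leq_exp2l // leq_divRL //; lia.
have [_ _ _ hv] := boundedP t.
have vlo := hv (lo i); have zhi := low_bound (hi i).
have zE : (x / D) ^+ i = (x / D) ^+ lo i * (x / D) ^+ hi i.
  by rewrite -exprD loE hiE; congr (_ ^+ _); lia.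
have pE : i.-1%:R = (lo i).-1%:R + (hi i).-1%:R + 1 :> R.
  have -> : i.-1 = ((lo i).-1 + (hi i).-1 + 1)%N by rewrite loE hiE; lia.
  by rewrite !natrD.
rewrite zE pE; move: elo ehi erun egap vlo zhi.
set e := 4^-1 ^+ (2 ^ k); set vl := value (latched (lo i)) t.
set vh := value (latched (hi i)) t; set zl := (x / D) ^+ lo i.
set zh := (x / D) ^+ hi i; set y := value _ t => elo ehi erun egap vlo zhi.
have -> : y - zl * zh = (y - vl * vh) + vl * (vh - zh) + (vl - zl) * zh by ring.
apply: (le_trans (ler_normD _ _)); rewrite normrM.
have h1 : `|vl - zl| * `|zh| <= `|vl - zl| by rewrite ler_piMr.
have h2 := ler_normD (y - vl * vh) (vl * (vh - zh)); rewrite normrM in h2.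
have h3 : `|vl| * `|vh - zh| <= `|vh - zh| by rewrite ler_piMl.
by lra.
Qed.

Lemma accurate_refine n t : value tick t = 0 -> accurate n t -> accurate n t.+1.
Proof.
move=> htick hn k m i k0 km im.
have [_ _ _ ->] := step_refine (boundedP t) htick; exact: hn k0 km im.
Qed.

(** The units react to a tick one step later, whence the clock at [t] and the units at [t.+1]. Time
    0 is excluded: the clock stands at the start of a gap there, but [tick] is 0. *)
Lemma unit_invariant t : (0 < t)%N ->
  squaring_invariant (clock L t).2 t.+1 /\ accurate (clock L t).1 t.+1.
Proof.
elim: t => // -[_ _|t /(_ isT) IHt _].
  have c1 : clock L 1 = (1, 0)%N by rewrite /= /gap div0n.
  have h : value tick 1 = 1 by rewrite value_tick // c1.
  rewrite c1 /=; split; first exact: restart_squaring.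
  (* Run 0 is not opened by a restart; [0 < k] keeps it out of the claim, leaving only the exact
     powers 0 and 1. *)
  move=> k m i k0 km; have -> : m = 0%N by nia.
  move=> i1.
  by rewrite (value_low _ i1).2 subrr normr0 mulr_ge0 // exprn_ge0 // invr_ge0.
have := value_tick L_gt0 t.+1; move: IHt.
rewrite [clock L t.+2]clockS.
case: (clock L t.+1) => n r [hS hn]; case: (r.+1 =P gap L n) => hr /= htick.
  split; first exact: restart_squaring.
  exact: accurate_restart hr hS hn.
split; first exact: refine_squaring.
exact: accurate_refine.
Qed.

End PolynomialNetwork.

(** * The output *)

(** The factor $D^i$ undoes the rescaling of $x$. As [linform] has no zero, [0 *: ck R N One] ends
    the sum. *)
Definition output (R : realType) (N : nat) (D : R) (a : 'I_N.+1 -> R) :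
    linform R (neuron N) :=
  foldr (fun i f => Ladd (Lscale (a i * D ^+ i) (latched R i)) f)
    (0 *: ck R N One)%lin (enum 'I_N.+1).

Lemma eval_output (R : realType) (N : nat) (D : R) (a : 'I_N.+1 -> R) h :
  lin_eval (output D a) h
  = \sum_(i < N.+1) a i * D ^+ i * lin_eval (latched R i) h.
Proof.
rewrite /output -[in RHS]big_enum /=.
elim: (enum _) => [|i s IHs]; first by rewrite big_nil /= mul0r.
by rewrite big_cons /= IHs.
Qed.

(** * The integer $L = \lceil \log N \rceil$ *)

Section Constants.
Variables (R : realType) (N : nat).
Hypothesis N_gt1 : (1 < N)%N.

Let ln2_gt0 : 0 < ln 2 :> R.
Proof. by rewrite ln_gt0 // ltr1n. Qed.

Lemma log2_ge1 : 1 <= log2 (N%:R : R).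
Proof.
rewrite /log2 ler_pdivlMr // mul1r ler_ln ?posrE ?ltr0n ?ler_nat //.
exact: ltnW.
Qed.

(** The last clause holds because $L < \log N + 1 \le 2 \log N$ for $N \ge 2$; it turns the
    assumption on $t$ into $8L \le t$. *)
Lemma ceil_log2 : exists L : nat,
  [/\ (0 < L)%N, Num.ceil (log2 (N%:R : R)) = L, (N <= 2 ^ L)%N
    & (8 * L)%:R <= 16 * log2 (N%:R : R)].
Proof.
have l1 := log2_ge1; have hge := ceil_ge (log2 (N%:R : R)).
have hlt : (Num.ceil (log2 (N%:R : R)))%:~R < log2 (N%:R : R) + 1.
  by have := ceilB1_lt (log2 (N%:R : R)); rewrite intrB; lra.
move: hge hlt; case: (Num.ceil _) => [L|k] hge hlt; last first.
  have : (Negz k)%:~R <= 0 :> R by rewrite lerz0.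
  by lra.
rewrite -pmulrn in hge hlt; exists L; split=> //.
- by rewrite -(ltr_nat R); lra.
- rewrite -(ler_nat R) natrX -ler_ln ?posrE ?exprn_gt0 ?ltr0n //; last exact: ltnW.
  by rewrite lnXn // -[_ *+ L]mulr_natl -ler_pdivrMr.
- by rewrite natrM; lra.
Qed.

End Constants.

(** * Error bound and size of the whole network *)

Theorem mainTheorem2 (R : realType) (N : nat) (hN : (1 <= N)%N)
    (D : R) (hD : 1 <= D) (a : 'I_N.+1 -> R) :
  exists net : RNN R 1 1,
    (forall (x : R) (t : nat),
        - D <= x <= D ->
        16 * log2 (N%:R : R) <= t%:R ->
        `| rnn_op net (impulse (const_mx x)) t ord0 ord0
           - \sum_(i < N.+1) a i * x ^+ i |
        <= (\sum_(i < N.+1) `|a i|) * C1 N D * decay R N t)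
    /\ (hidden_size net <= 80 * N + 11)%N.
Proof.
pose net L := linform_net (inl (inl One)) (preact R (N := N) L) (@bias R N)
  (input_weight D) (output D a).
have size_net L : (hidden_size (net L) <= 80 * N + 11)%N.
  by apply: (leq_trans (card_neuron N)); lia.
have D0 : 0 < D by lra.
have netE L x t : rnn_op (net L) (impulse (const_mx x)) t ord0 ord0
    - \sum_(i < N.+1) a i * x ^+ i
    = \sum_(i < N.+1) a i * D ^+ i * (value L D x (latched R i) t - (x / D) ^+ i).
  rewrite linform_netE eval_output -sumrB; apply: eq_bigr => i _.
  rewrite mulrBr; congr (_ - _); rewrite -mulrA -exprMn mulrCA divff ?mulr1 //.
  exact: lt0r_neq0.
have [N1|N1] := leqP N 1.
  (* For $N = 1$ the right-hand side is 0, and the powers 0 and 1 are exact at every time, for any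
     clock. *)
  exists (net 1%N); split=> // x t _ _; rewrite netE big1 ?normr0 => [|i _].
    have /eqP e1 : N = 1%N by lia.
    by rewrite /decay e1 mulr0.
  have i1 : (i <= 1)%N by have := ltn_ord i; lia.
  by rewrite (value_low 1 D x t i1).2 subrr mulr0.
have [L [L0 hL NL tL]] := ceil_log2 R N1.
exists (net L); split=> // x t /andP[x1 x2] ht; rewrite netE.
have xD : `|x / D| <= 1.
  by rewrite normf_div (gtr0_norm D0) ler_pdivrMr // mul1r ler_norml x1.
have {tL ht} tL : (8 * L <= t)%N by rewrite -(ler_nat R); apply: le_trans ht.
case: t tL => [|t] tL; first by lia.
have t0 : (0 < t)%N by lia.
have := (@unit_invariant R N L D x L0 xD t t0).2; have := clock_time t L0; have := clock_lt L t.
case: (clock L t) => n r /=; rewrite /gap => rlt tE acc.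
have ltL := ltn_pmod n L0.
have tq : (t.+1 + L <= 2 * L * 2 ^ (n %/ L))%N by nia.
have q2 : (2 <= n %/ L)%N by case: (n %/ L)%N tq => [|[|//]]; rewrite ?expn0 ?expn1; nia.
(* The last $L$ complete runs have index at least $n - L \ge qL$, hence length at least $2^q$. They
   cover the depth $L$ of the tree, and $t + 1 \le 4L \cdot 2^q$ gives the rate. *)
set q := (n %/ L).-1%N.
have q0 : (0 < q)%N by rewrite /q; lia.
have qE : (n %/ L = q.+1)%N by rewrite /q; lia.
have qn : (q * L + L <= n)%N by rewrite addnC -mulSn -qE leq_trunc_div.
have {tq} tq : (t.+1 <= 4 * L * 2 ^ q)%N by move: tq; rewrite qE expnS; nia.
have err (i : 'I_N.+1) : `|value L D x (latched R i) t.+1 - (x / D) ^+ i|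
    <= N%:R * 4^-1 ^+ (2 ^ q).
  have iL : (i <= 2 ^ L)%N := leq_trans (ltn_ord i : (i <= N)%N) NL.
  apply: (le_trans (acc q L i q0 qn iL)).
  rewrite ler_wpM2r ?exprn_ge0 ?invr_ge0 // ler_nat.
  by have := ltn_ord i; lia.
have dec : 4^-1 ^+ (2 ^ q) <= decay R N t.+1.
  rewrite /decay ifN ?gtn_eqF // /C2 hL -pmulrn exprVn -powR_invn //.
  apply: ler_powR; first by rewrite ler1n.
  rewrite lerN2 mulrC ler_pdivrMr ?mulr_gt0 ?ltr0n //.
  by move: tq; rewrite -(ler_nat R) !natrM; lra.
apply: (le_trans (ler_norm_sum _ _ _)); rewrite -mulrA mulr_suml.
apply: ler_sum => i _; rewrite !normrM -mulrA ler_wpM2l //.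
have iN : (i <= N)%N := ltn_ord i.
have Di : `|D ^+ i| <= D ^+ (2 * N).
  by rewrite (ger0_norm (exprn_ge0 _ (ltW D0))) ler_weXn2l //; lia.
apply: (le_trans (ler_pM _ _ Di (err i))) => //.
rewrite /C1; have dec0 : 0 <= decay R N t.+1 by apply: le_trans dec; rewrite exprn_ge0.
have DN0 : 0 <= D ^+ (2 * N) by rewrite exprn_ge0 // ltW.
have h : N%:R * 4^-1 ^+ (2 ^ q) <= 16 * (N%:R * decay R N t.+1).
  have ND : 0 <= N%:R * decay R N t.+1 by rewrite mulr_ge0.
  by apply: (@le_trans _ _ (N%:R * decay R N t.+1)); [rewrite ler_wpM2l|lra].
apply: (le_trans (ler_wpM2l DN0 h)).
by rewrite [leRHS](_ : _ = D ^+ (2 * N) * (16 * (N%:R * decay R N t.+1))) //; ring.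
Qed.
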